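(* Let $\mathbb{K}$ be a field; all Hom-Leibniz algebras are multiplicative and over $\mathbb{K}$. a) If a central extension $0 \to (M, \alpha_M) \xrightarrow{i} (K,\alpha_K) \xrightarrow{\pi} (L, \alpha_L) \to 0$ of Hom-Leibniz algebras is a universal $\alpha$-central extension, then $(K,\alpha_K)$ is a perfect Hom-Leibniz algebra and every central extension of $(K,\alpha_K)$ splits. b) Let $0 \to (M, \alpha_M) \xrightarrow{i} (K,\alpha_K) \xrightarrow{\pi} (L, \alpha_L) \to 0$ be a central extension of Hom-Leibniz algebras. If $(K,\alpha_K)$ is a perfect Hom-Leibniz algebra and every central extension of $(K,\alpha_K)$ splits, then $0 \to (M, \alpha_M) \xrightarrow{i} (K,\alpha_K) \xrightarrow{\pi} (L, \alpha_L) \to 0$ is a universal central extension. c) A Hom-Leibniz algebra $(L, \alpha_L)$ admits a universal central extension if and only if $(L, \alpha_L)$ is perfect. d) The kernel of the universal central extension of a perfect Hom-Leibniz algebra $(L,\alpha_L)$ is canonically isomorphic to $HL_2^{\alpha}(L)$.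
   Context: A (multiplicative) Hom-Leibniz algebra $(L,[-,-],\alpha_L)$, abbreviated $(L,\alpha_L)$, is a $\mathbb{K}$-vector space $L$ with a bilinear map $[-,-]:L\times L\to L$ and a linear map $\alpha_L:L\to L$ such that $[\alpha_L(x),[y,z]]=[[x,y],\alpha_L(z)]-[[x,z],\alpha_L(y)]$ and $\alpha_L[x,y]=[\alpha_L(x),\alpha_L(y)]$ for all $x,y,z\in L$. A homomorphism $f:(L,\alpha_L)\to(L',\alpha_{L'})$ is a linear map preserving brackets with $f\circ\alpha_L=\alpha_{L'}\circ f$. $(L,\alpha_L)$ is perfect if $L=[L,L]$, where $[L,L]$ is the span of all brackets. The center is $Z(L)=\{x\in L : [x,y]=0=[y,x] \text{ for all } y\in L\}$. A short exact sequence of Hom-Leibniz algebras $0 \to (M, \alpha_M) \xrightarrow{i} (K,\alpha_K) \xrightarrow{\pi} (L, \alpha_L) \to 0$ (where $M$ is identified with $\ker\pi$ and $\alpha_M$ is the restriction of $\alpha_K$) is called a central extension of $(L,\alpha_L)$ if $[M,K]=0=[K,M]$, i.e. $M\subseteq Z(K)$; it is called an $\alpha$-central extension if $[\alpha_M(M),K]=0=[K,\alpha_M(M)]$, i.e. $\alpha_M(M)\subseteq Z(K)$. It splits if there is a homomorphism of Hom-Leibniz algebras $\sigma:(L,\alpha_L)\to(K,\alpha_K)$ with $\pi\circ\sigma=\mathrm{Id}$. A central extension $\pi:(K,\alpha_K)\to(L,\alpha_L)$ is universal (respectively, universal $\alpha$-central) if for every central (respectively, $\alpha$-central) extension $\pi':(K',\alpha_{K'})\to(L,\alpha_L)$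 there exists a unique homomorphism of Hom-Leibniz algebras $h:(K,\alpha_K)\to(K',\alpha_{K'})$ with $\pi'\circ h=\pi$. (So a universal $\alpha$-central extension is by definition itself a central extension.) $HL_2^{\alpha}(L)=\ker d_2/\operatorname{im} d_3$ (second homology with trivial coefficients in $\mathbb{K}$), where $d_2:L\otimes L\to L$, $d_2(x_1\otimes x_2)=-[x_1,x_2]$, and $d_3:L^{\otimes 3}\to L^{\otimes 2}$, $d_3(x_1\otimes x_2\otimes x_3)=-[x_1,x_2]\otimes\alpha_L(x_3)+[x_1,x_3]\otimes\alpha_L(x_2)+\alpha_L(x_1)\otimes[x_2,x_3]$. *)

(* Defs.v *)
From HB Require Import structures.
From mathcomp Require Import all_boot all_algebra.
From mathcomp Require Import boolp.
From mathcomp Require Import freeg.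

Set Implicit Arguments.
Unset Strict Implicit.
Unset Printing Implicit Defensive.

Import GRing.Theory.
Local Open Scope ring_scope.
Local Open Scope quotient_scope.

Reserved Notation "⟦ x , y ⟧" (at level 0, x at level 99, y at level 99,
  format "⟦ x ,  y ⟧").
Reserved Notation "x ⊗ y" (at level 40, left associativity).

(** * Spans, kernels and quotients of vector spaces *)

Section Span.
Variables (F : fieldType) (V : lmodType F).

Definition span (S : V -> Prop) : {pred V} := fun v =>
  `[< exists (n : nat) (c : 'I_n -> F) (w : 'I_n -> V),
        (forall i, S (w i)) /\ v = \sum_i c i *: w i >].

Lemma spanP (S : V -> Prop) (v : V) :
  v \in span S <-> exists (n : nat) (c : 'I_n -> F) (w : 'I_n -> V),
        (forall i, S (w i)) /\ v = \sum_i c i *: w i.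
Proof. by split=> [/asboolP|?]; last exact/asboolP. Qed.

Lemma mem_span (S : V -> Prop) (v : V) : S v -> v \in span S.
Proof.
by move=> Sv; apply/spanP; exists 1%N, (fun=> 1), (fun=> v); rewrite big_ord1 scale1r.
Qed.

Lemma span_submod_closed S : submod_closed (span S).
Proof.
split=> [|a u v /spanP[n [c [w [Sw ->]]]] /spanP[m [d [x [Sx ->]]]]].
  by apply/spanP; exists 0%N, (fun=> 0), (fun=> 0); split=> [[]//|]; rewrite big_ord0.
apply/spanP; exists (n + m)%N.
exists (fun i => match split i with inl j => a * c j | inr j => d j end).
exists (fun i => match split i with inl j => w j | inr j => x j end).
split=> [i|]; first by case: (split i).
rewrite big_split_ord /= scaler_sumr; congr (_ + _); apply: eq_bigr => i _.
  by rewrite (unsplitK (inl i)) scalerA.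
by rewrite (unsplitK (inr i)).
Qed.

HB.instance Definition _ S :=
  GRing.isSubmodClosed.Build F V (span S) (span_submod_closed S).

(* [span S] is the least subspace containing [S] *)
Lemma span_min (S : V -> Prop) (W : submodClosed V) :
  (forall v, S v -> v \in W) -> {subset span S <= W}.
Proof.
move=> SW v /spanP[n [c [w [Sw ->]]]]; apply: rpred_sum => i _.
by apply: rpredZ; apply: SW.
Qed.

End Span.

Section Kernel.
Variables (F : fieldType) (U V : lmodType F) (f : {linear U -> V}).

Definition inker : {pred U} := fun x => f x == 0.

Lemma inker_submod_closed : submod_closed inker.
Proof.
by split=> [|a u v]; rewrite !unfold_in ?linear0 // linearP => /eqP-> /eqP->;
  rewrite scaler0 addr0.
Qed.

HB.instance Definition _ :=
  GRing.isSubmodClosed.Build F U inker inker_submod_closed.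

Record kernel := Kernel { kernel_val :> U; _ : kernel_val \in inker }.

HB.instance Definition _ := [isSub for kernel_val].
HB.instance Definition _ := [Choice of kernel by <:].
HB.instance Definition _ := [SubChoice_isSubLmodule of kernel by <:].

Lemma kernelP (x : kernel) : f (val x) = 0.
Proof. by apply/eqP; case: x. Qed.

End Kernel.

Section Image.
Variables (F : fieldType) (U V : lmodType F) (f : {linear U -> V}).

Definition inim : {pred V} := fun y => `[< exists x, f x = y >].

Lemma inimP y : y \in inim <-> exists x, f x = y.
Proof. by split=> [/asboolP|?]; last exact/asboolP. Qed.

Lemma inim_submod_closed : submod_closed inim.
Proof.
split=> [|a u v /inimP[x <-] /inimP[y <-]]; apply/inimP.
  by exists 0; rewrite linear0.
by exists (a *: x + y); rewrite linearP.
Qed.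

HB.instance Definition _ :=
  GRing.isSubmodClosed.Build F V inim inim_submod_closed.

End Image.

(* MathComp's quotient of a [zmodType], with its scaling *)
Section LQuot.
Variables (F : fieldType) (V : lmodType F) (W : submodClosed V).

(* [submodClosed] does not bundle closure under opposites, which [Quotient.quot]
   asks for *)
Definition zmod_pred : {pred V} := fun v => v \in W.

Lemma zmod_pred_closed : zmod_closed zmod_pred.
Proof.
split=> [|u v]; rewrite ![_ \in zmod_pred]unfold_in /zmod_pred ?rpred0 // => uW vW.
by rewrite -scaleN1r; apply: rpredD => //; apply: rpredZ.
Qed.

HB.instance Definition _ := GRing.isZmodClosed.Build V zmod_pred zmod_pred_closed.

Definition lquot := Quotient.quot zmod_pred.
HB.instance Definition _ := GRing.Zmodule.on lquot.

Definition lclass (v : V) : lquot := \pi_(Quotient.quot zmod_pred) v.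

Lemma lclass_eq u v : lclass u = lclass v <-> u - v \in W.
Proof.
rewrite /lclass; split=> [/eqP|uv]; first by rewrite -Quotient.idealrBE.
by apply/eqP; rewrite -Quotient.idealrBE.
Qed.

Lemma lclassW (P : lquot -> Prop) : (forall v, P (lclass v)) -> forall x, P x.
Proof. by move=> PV x; have := PV (repr x); rewrite /lclass reprK. Qed.

Lemma lclass_additive : zmod_morphism lclass.
Proof. by move=> u v; rewrite /lclass raddfB. Qed.

HB.instance Definition _ :=
  GRing.isZmodMorphism.Build V lquot lclass lclass_additive.

Definition lquot_scale (a : F) (x : lquot) : lquot := lclass (a *: repr x).

Lemma lquot_scaleE a v : lquot_scale a (lclass v) = lclass (a *: v).
Proof.
apply/lclass_eq; rewrite -scalerBr; apply: rpredZ.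
by apply/lclass_eq; rewrite /lclass reprK.
Qed.

Fact lquot_scaleA a b x :
  lquot_scale a (lquot_scale b x) = lquot_scale (a * b) x.
Proof. by elim/lclassW: x => v; rewrite !lquot_scaleE scalerA. Qed.

Fact lquot_scale1 : left_id 1 lquot_scale.
Proof. by elim/lclassW => v; rewrite lquot_scaleE scale1r. Qed.

Fact lquot_scaleDr : right_distributive lquot_scale +%R.
Proof.
by move=> a; elim/lclassW => u; elim/lclassW => v;
  rewrite -raddfD !lquot_scaleE scalerDr raddfD.
Qed.

Fact lquot_scaleDl x : {morph lquot_scale^~ x : a b / a + b}.
Proof. by move=> a b; elim/lclassW: x => v; rewrite !lquot_scaleE scalerDl raddfD. Qed.

HB.instance Definition _ := GRing.Zmodule_isLmodule.Build F lquot
  lquot_scaleA lquot_scale1 lquot_scaleDr lquot_scaleDl.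

Lemma lclass_scalable : scalable lclass.
Proof. by move=> a v; rewrite -lquot_scaleE. Qed.

HB.instance Definition _ :=
  GRing.isScalable.Build F V lquot *:%R lclass lclass_scalable.

Lemma lclass_eq0 v : lclass v = 0 <-> v \in W.
Proof. by rewrite -(raddf0 lclass) lclass_eq subr0. Qed.

Section Lift.
Variables (X : lmodType F) (f : {linear V -> X}).
Hypothesis fW : forall v, v \in W -> f v = 0.

Definition lquot_lift of (forall v, v \in W -> f v = 0) :=
  fun x : lquot => f (repr x).

Lemma lquot_liftE v : lquot_lift fW (lclass v) = f v.
Proof.
apply/eqP; rewrite -subr_eq0 -raddfB; apply/eqP/fW.
by apply/lclass_eq; rewrite /lclass reprK.
Qed.

Lemma lquot_lift_linear : linear (lquot_lift fW).
Proof.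
by move=> a; elim/lclassW => u; elim/lclassW => v;
  rewrite -linearP !lquot_liftE linearP.
Qed.

HB.instance Definition _ :=
  GRing.isLinear.Build F lquot X *:%R (lquot_lift fW) lquot_lift_linear.

End Lift.
End LQuot.

(** * Tensor products of vector spaces *)

Section FreeLift.
Variables (F : fieldType) (X : choiceType) (V : lmodType F) (f : X -> V).

HB.instance Definition _ :=
  GRing.isZmodMorphism.Build {freeg X / F} V (fglift f) (lift_is_additive f).

Lemma fglift_scalable : scalable (fglift f).
Proof.
move=> a D; rewrite -(freeg_sumE D).
rewrite scaler_sumr !raddf_sum; apply: eq_bigr => x _ /=.
suff -> : a *: << coeff x D *g x >> = << a * coeff x D *g x >> :> {freeg X / F}.
  by rewrite !liftU scalerA.
by apply/eqP/freeg_eqP => y; rewrite coeffZ !coeffU mulrA.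
Qed.

HB.instance Definition _ :=
  GRing.isScalable.Build F {freeg X / F} V *:%R (fglift f) fglift_scalable.

End FreeLift.

Section Tensor.
Variables (F : fieldType) (U V : lmodType F).

Local Notation gen u v := (<< (u, v) >> : {freeg (U * V)%type / F}).

Definition tens_relator (r : {freeg (U * V)%type / F}) : Prop :=
  (exists a u u' v, r = gen (a *: u + u') v - (a *: gen u v + gen u' v)) \/
  (exists a u v v', r = gen u (a *: v + v') - (a *: gen u v + gen u v')).

Definition tensor := lquot (span tens_relator).
HB.instance Definition _ := GRing.Lmodule.on tensor.

Definition tens (u : U) (v : V) : tensor := lclass (span tens_relator) (gen u v).

Lemma tens_linearl v : linear (tens^~ v).
Proof.
move=> a u u'; rewrite /tens -linearP; apply/lclass_eq/mem_span.
by left; exists a, u, u', v.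
Qed.

Lemma tens_linearr u : linear (tens u).
Proof.
move=> a v v'; rewrite /tens -linearP; apply/lclass_eq/mem_span.
by right; exists a, u, v, v'.
Qed.

Lemma tens_bilinear : bilinear_for *:%R *:%R tens.
Proof. by split=> ?; [exact: tens_linearl | exact: tens_linearr]. Qed.

HB.instance Definition _ :=
  bilinear_isBilinear.Build F U V tensor *:%R *:%R tens tens_bilinear.

Lemma tens_gen (x : tensor) : exists (n : nat) (u : 'I_n -> U) (v : 'I_n -> V),
  x = \sum_i tens (u i) (v i).
Proof.
elim/lclassW: x => D; rewrite -(freeg_sumE D) [lclass _ _]raddf_sum.
set s := dom D; exists (size s).
exists (fun i => coeff (tnth (in_tuple s) i) D *: (tnth (in_tuple s) i).1).
exists (fun i => (tnth (in_tuple s) i).2).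
rewrite big_tnth; apply: eq_bigr => i _.
case: (tnth _ i) => u v /=; rewrite (scalable_linear (tens_linearl v)) /tens -linearZ.
congr (lclass _ _); apply/eqP/freeg_eqP => y.
by rewrite coeffZ !coeffU mul1r.
Qed.

Section Lift.
Variables (W : lmodType F) (f : {bilinear U -> V -> W}).

Let g : {linear {freeg (U * V)%type / F} -> W} :=
  fglift (fun p : U * V => f p.1 p.2).

Let gE u v : g (gen u v) = f u v.
Proof. by rewrite /g /= liftU scale1r. Qed.

Lemma tens_lift_subproof r : r \in span tens_relator -> g r = 0.
Proof.
move=> rR; apply/eqP; rewrite -[_ == _]/(r \in inker g).
apply: span_min rR => {}r [[a [u [u' [v ->]]]]|[a [u [v [v' ->]]]]].
  by rewrite unfold_in linearB linearP !gE linearPl subrr.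
by rewrite unfold_in linearB linearP !gE linearPr subrr.
Qed.

Definition tens_lift : tensor -> W := lquot_lift tens_lift_subproof.
HB.instance Definition _ := GRing.Linear.on tens_lift.

Lemma tens_liftE u v : tens_lift (tens u v) = f u v.
Proof. by rewrite /tens_lift /tens lquot_liftE gE. Qed.

End Lift.

Lemma tens_ext (W : lmodType F) (f g : {linear tensor -> W}) :
  (forall u v, f (tens u v) = g (tens u v)) -> f =1 g.
Proof.
move=> fg x; have [n [u [v ->]]] := tens_gen x.
by rewrite !raddf_sum; apply: eq_bigr => i _; exact: fg.
Qed.

End Tensor.

Notation "x ⊗ y" := (tens x y) : ring_scope.
Notation "U ⊗ V" := (tensor U V) : type_scope.

(** * Hom-Leibniz algebras *)

HB.mixin Record isHomLeibniz (F : fieldType) (L : Type) of GRing.Lmodule F L := {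
  brkt : L -> L -> L;
  twist : L -> L;
  brkt_linearl : forall y, linear (brkt^~ y);
  brkt_linearr : forall x, linear (brkt x);
  twist_linear : linear twist;
  hom_leibniz : forall x y z,
    brkt (twist x) (brkt y z) = brkt (brkt x y) (twist z) - brkt (brkt x z) (twist y);
  twist_brkt : forall x y, twist (brkt x y) = brkt (twist x) (twist y)
}.

#[short(type="homLeibnizType")]
HB.structure Definition HomLeibniz (F : fieldType) :=
  {L of isHomLeibniz F L & GRing.Lmodule F L}.

Notation "⟦ x , y ⟧" := (brkt x y) : ring_scope.

Section HomLeibnizTheory.
Variables (F : fieldType) (L : homLeibnizType F).

Lemma brkt_bilinear : bilinear_for *:%R *:%R (@brkt F L).
Proof. by split=> ?; [exact: brkt_linearl | exact: brkt_linearr]. Qed.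

HB.instance Definition _ :=
  bilinear_isBilinear.Build F L L L *:%R *:%R (@brkt F L) brkt_bilinear.
HB.instance Definition _ :=
  GRing.isLinear.Build F L L *:%R (@twist F L) twist_linear.

Definition center (x : L) : Prop := forall y, ⟦x, y⟧ = 0 /\ ⟦y, x⟧ = 0.

Definition perfect : Prop :=
  forall x : L, x \in span (fun z : L => exists a b, z = ⟦a, b⟧).

End HomLeibnizTheory.

Arguments perfect {F} L.

HB.mixin Record isHomLeibnizMorphism (F : fieldType) (L L' : homLeibnizType F)
    (f : L -> L') := {
  hlmorph_brkt : forall x y, f ⟦x, y⟧ = ⟦f x, f y⟧;
  hlmorph_twist : forall x, f (twist x) = twist (f x)
}.

#[short(type="hlmorphism")]
HB.structure Definition HomLeibnizMorphism (F : fieldType) (L L' : homLeibnizType F) :=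
  {f of isHomLeibnizMorphism F L L' f & @GRing.Linear F L L' *:%R f}.

(** * Extensions *)

Section Extensions.
Variable F : fieldType.
Implicit Types M K L : homLeibnizType F.

Definition short_exact M K L (i : hlmorphism M K) (p : hlmorphism K L) : Prop :=
  [/\ injective i,
      forall k, p k = 0 <-> exists m, i m = k
    & forall l, exists k, p k = l].

Definition central_extension M K L (i : hlmorphism M K) (p : hlmorphism K L) :=
  short_exact i p /\ forall m, center (i m).

Definition alpha_central_extension M K L (i : hlmorphism M K) (p : hlmorphism K L) :=
  short_exact i p /\ forall m, center (i (twist m)).

Definition splits K L (p : hlmorphism K L) : Prop :=
  exists s : hlmorphism L K, forall l, p (s l) = l.

(* There is a unique homomorphism over L between the two extensions. *)
Definition unique_lift K K' L (p : hlmorphism K L) (p' : hlmorphism K' L) : Prop :=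
  exists h : hlmorphism K K', (forall k, p' (h k) = p k) /\
    forall h' : hlmorphism K K', (forall k, p' (h' k) = p k) -> h' =1 h.

Definition universal_central_extension M K L
    (i : hlmorphism M K) (p : hlmorphism K L) : Prop :=
  central_extension i p /\
  forall M' K' (i' : hlmorphism M' K') (p' : hlmorphism K' L),
    central_extension i' p' -> unique_lift p p'.

Definition universal_alpha_central_extension M K L
    (i : hlmorphism M K) (p : hlmorphism K L) : Prop :=
  central_extension i p /\
  forall M' K' (i' : hlmorphism M' K') (p' : hlmorphism K' L),
    alpha_central_extension i' p' -> unique_lift p p'.

Definition every_central_extension_splits K : Prop :=
  forall M' K' (i' : hlmorphism M' K') (p' : hlmorphism K' K),
    central_extension i' p' -> splits p'.

End Extensions.

(** * Second homology with trivial coefficients *)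

Section Homology.
Variables (F : fieldType) (L : homLeibnizType F).

Definition d2_fun (x y : L) : L := - ⟦x, y⟧.

Lemma d2_bilinear : bilinear_for *:%R *:%R d2_fun.
Proof.
by split=> [y a x x'|x a y y']; rewrite /d2_fun (linearPl, linearPr) /= opprD scalerN.
Qed.

HB.instance Definition _ :=
  bilinear_isBilinear.Build F L L L *:%R *:%R d2_fun d2_bilinear.

Definition d2 : (L ⊗ L)%type -> L := tens_lift d2_fun.
HB.instance Definition _ := GRing.Linear.on d2.

Lemma d2E x y : d2 (x ⊗ y) = - ⟦x, y⟧.
Proof. exact: tens_liftE. Qed.

Definition d3_fun (z : L) (x y : L) : (L ⊗ L)%type :=
  - (⟦x, y⟧ ⊗ twist z) + ⟦x, z⟧ ⊗ twist y + twist x ⊗ ⟦y, z⟧.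

Lemma d3_bilinear z : bilinear_for *:%R *:%R (d3_fun z).
Proof.
split=> [y a x x'|x a y y'];
  rewrite /d3_fun (linearP twist) !(linearPl, linearPr) /=;
  by rewrite opprD !scalerDr scalerN [X in X + _ = _]addrACA [LHS]addrACA.
Qed.

HB.instance Definition _ z :=
  bilinear_isBilinear.Build F L L (L ⊗ L)%type *:%R *:%R (d3_fun z) (d3_bilinear z).

Definition d3_fun2 (t : (L ⊗ L)%type) (z : L) : (L ⊗ L)%type :=
  tens_lift (d3_fun z) t.

Lemma d3_bilinear2 : bilinear_for *:%R *:%R d3_fun2.
Proof.
split=> [z|t a z z']; first exact: linearP.
have [n [u [v ->]]] := tens_gen t; rewrite /d3_fun2 ![tens_lift _ _]raddf_sum /= scaler_sumr -big_split.
apply: eq_bigr => i _ /=; rewrite !tens_liftE /= /d3_fun.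
rewrite (linearP twist) !(linearPl, linearPr) /=.
by rewrite opprD !scalerDr scalerN [X in X + _ = _]addrACA [LHS]addrACA.
Qed.

HB.instance Definition _ :=
  bilinear_isBilinear.Build F (L ⊗ L)%type L (L ⊗ L)%type *:%R *:%R d3_fun2 d3_bilinear2.

Definition d3 : ((L ⊗ L) ⊗ L)%type -> (L ⊗ L)%type := tens_lift d3_fun2.
HB.instance Definition _ := GRing.Linear.on d3.

Lemma d3E x1 x2 x3 : d3 (x1 ⊗ x2 ⊗ x3) =
  - (⟦x1, x2⟧ ⊗ twist x3) + ⟦x1, x3⟧ ⊗ twist x2 + twist x1 ⊗ ⟦x2, x3⟧.
Proof. by rewrite /d3 tens_liftE /= /d3_fun2 tens_liftE. Qed.

Lemma d2_d3 t : d2 (d3 t) = 0.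
Proof.
have [n [u [z ->]]] := tens_gen t; rewrite !raddf_sum big1 // => i _.
have [m [x [y ->]]] := tens_gen (u i); rewrite linear_sumlz !raddf_sum big1 // => j _.
rewrite /= d3E !linearD linearN /= !d2E hom_leibniz opprK opprB.
by rewrite addrA addrNK subrr.
Qed.

Lemma d3_cycle t : d3 t \in inker d2.
Proof. by apply/eqP; exact: d2_d3. Qed.

(* d3 corestricted to ker d2 *)
Definition d3_cor_fun (t : ((L ⊗ L) ⊗ L)%type) : kernel d2 := Kernel (d3_cycle t).

Lemma d3_cor_linear : linear d3_cor_fun.
Proof. by move=> a s t; apply: val_inj; rewrite /= linearP. Qed.

HB.instance Definition _ :=
  GRing.isLinear.Build F ((L ⊗ L) ⊗ L)%type (kernel d2) *:%R d3_cor_fun d3_cor_linear.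

Definition HL2 := lquot (inim d3_cor_fun).
HB.instance Definition _ := GRing.Lmodule.on HL2.

Definition HL2_class : kernel d2 -> HL2 := lclass (inim d3_cor_fun).
HB.instance Definition _ := GRing.Linear.on HL2_class.

End Homology.

Arguments d2 {F} L.
Arguments d3 {F} L.
Arguments HL2 {F} L.

(* For a central extension p, the bracket of K depends only on the images of its
   arguments in L, hence factors through a linear map psi : L ⊗ L -> K, which
   vanishes on im d3 and maps ker d2 to ker p.  The canonical map
   phi : HL2 L -> M ~ ker p is the one induced by psi. *)
Definition canonical_HL2_map (F : fieldType) (M K L : homLeibnizType F)
    (i : hlmorphism M K) (p : hlmorphism K L) (phi : HL2 L -> M) : Prop :=
  exists psi : {linear (L ⊗ L)%type -> K},
    (forall x y : K, psi (p x ⊗ p y) = ⟦x, y⟧) /\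
    (forall z : kernel (@d2 F L), i (phi (HL2_class z)) = psi (kernel_val z)).

(* Main.v *)
(** In a central extension p : K -> L the bracket of K depends only on the images
    under p, so homomorphisms over L from a perfect algebra into K agree on
    brackets and hence everywhere; this gives all uniqueness claims.
    (a) Uniqueness of lifts of p to L x K/[K,K] forces K to be perfect; if q is a
    central extension of K then p \o q is alpha-central, and the lift of p
    through p \o q is a section of q.  (b) Split the pullback to K of a given
    central extension of L.  (c) For perfect L, uce L = (L ⊗ L)/im d3 with bracket
    [s, t] = (proj s) ⊗ (proj t), where proj (x ⊗ y) = [x, y], is perfect and maps to
    every central extension by x ⊗ y |-> [x', y'], x' and y' being any preimages.
    (d) The kernel of proj is ker d2 / im d3, and universal central extensions of
    L are isomorphic over L. *)

From HB Require Import structures.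
From mathcomp Require Import all_boot all_algebra.
From mathcomp Require Import boolp.
Require Import Defs.

Set Implicit Arguments.
Unset Strict Implicit.
Unset Printing Implicit Defensive.

Import GRing.Theory.
Local Open Scope ring_scope.

(** * Constructions on Hom-Leibniz algebras *)

Section Morphisms.
Variable F : fieldType.
Implicit Types K L : homLeibnizType F.

Lemma idfun_brkt L (x y : L) : idfun ⟦x, y⟧ = ⟦idfun x, idfun y⟧.
Proof. by []. Qed.
Lemma idfun_twist L (x : L) : idfun (twist x) = twist (idfun x).
Proof. by []. Qed.
HB.instance Definition _ L :=
  isHomLeibnizMorphism.Build F L L idfun (@idfun_brkt L) (@idfun_twist L).

Section Comp.
Variables (J K L : homLeibnizType F) (f : hlmorphism K L) (g : hlmorphism J K).
Lemma comp_brkt x y : (f \o g) ⟦x, y⟧ = ⟦(f \o g) x, (f \o g) y⟧.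
Proof. by rewrite /= !hlmorph_brkt. Qed.
Lemma comp_twist x : (f \o g) (twist x) = twist ((f \o g) x).
Proof. by rewrite /= !hlmorph_twist. Qed.
HB.instance Definition _ :=
  isHomLeibnizMorphism.Build F J L (f \o g) comp_brkt comp_twist.
End Comp.
End Morphisms.

(** * Subspaces closed under bracket and twist *)

Section SubAlgebra.
Variables (F : fieldType) (L : homLeibnizType F) (W : submodClosed L).

(** The closure proofs are parameters of the type so that structure inference can recover the
    bracket and the twist from the type alone. *)
Record subalg (Wbrkt : forall x y, x \in W -> y \in W -> ⟦x, y⟧ \in W)
    (Wtwist : forall x, x \in W -> twist x \in W) :=
  Subalg { subalg_val :> L; _ : subalg_val \in W }.

Variables (Wbrkt : forall x y, x \in W -> y \in W -> ⟦x, y⟧ \in W)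
          (Wtwist : forall x, x \in W -> twist x \in W).
Local Notation S := (subalg Wbrkt Wtwist).

HB.instance Definition _ := [isSub for @subalg_val Wbrkt Wtwist].
HB.instance Definition _ := [Choice of S by <:].
HB.instance Definition _ := [SubChoice_isSubLmodule of S by <:].

Definition subalg_brkt (x y : S) : S := Subalg _ _ (Wbrkt (valP x) (valP y)).
Definition subalg_twist (x : S) : S := Subalg _ _ (Wtwist (valP x)).

Fact subalg_brktl y : linear (subalg_brkt^~ y).
Proof. by move=> a u v; apply: val_inj; rewrite /= linearPl. Qed.
Fact subalg_brktr x : linear (subalg_brkt x).
Proof. by move=> a u v; apply: val_inj; rewrite /= linearPr. Qed.
Fact subalg_twist_linear : linear subalg_twist.
Proof. by move=> a u v; apply: val_inj; rewrite /= linearP. Qed.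
Fact subalg_leibniz x y z : subalg_brkt (subalg_twist x) (subalg_brkt y z) =
  subalg_brkt (subalg_brkt x y) (subalg_twist z)
    - subalg_brkt (subalg_brkt x z) (subalg_twist y).
Proof. by apply: val_inj; rewrite /= hom_leibniz. Qed.
Fact subalg_twist_brkt x y : subalg_twist (subalg_brkt x y) =
  subalg_brkt (subalg_twist x) (subalg_twist y).
Proof. by apply: val_inj; rewrite /= twist_brkt. Qed.

HB.instance Definition _ := isHomLeibniz.Build F S subalg_brktl subalg_brktr
  subalg_twist_linear subalg_leibniz subalg_twist_brkt.

Fact subalg_val_linear : linear (@subalg_val Wbrkt Wtwist).
Proof. by []. Qed.
HB.instance Definition _ :=
  GRing.isLinear.Build F S L *:%R (@subalg_val Wbrkt Wtwist) subalg_val_linear.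
Fact subalg_val_brkt (x y : S) : subalg_val ⟦x, y⟧ = ⟦subalg_val x, subalg_val y⟧.
Proof. by []. Qed.
Fact subalg_val_twist (x : S) : subalg_val (twist x) = twist (subalg_val x).
Proof. by []. Qed.
HB.instance Definition _ := isHomLeibnizMorphism.Build F S L
  (@subalg_val Wbrkt Wtwist) subalg_val_brkt subalg_val_twist.

End SubAlgebra.

(** * Direct products and pairings *)

Section Product.
Variables (F : fieldType) (K L : homLeibnizType F).
Local Notation P := (K * L)%type.

Definition prod_brkt (x y : P) : P := (⟦x.1, y.1⟧, ⟦x.2, y.2⟧).
Definition prod_twist (x : P) : P := (twist x.1, twist x.2).

Fact prod_brktl y : linear (prod_brkt^~ y).
Proof. by move=> a u v; rewrite /prod_brkt !linearPl. Qed.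
Fact prod_brktr x : linear (prod_brkt x).
Proof. by move=> a u v; rewrite /prod_brkt !linearPr. Qed.
Fact prod_twist_linear : linear prod_twist.
Proof. by move=> a u v; rewrite /prod_twist !linearP. Qed.
Fact prod_leibniz x y z : prod_brkt (prod_twist x) (prod_brkt y z) =
  prod_brkt (prod_brkt x y) (prod_twist z) - prod_brkt (prod_brkt x z) (prod_twist y).
Proof. by rewrite /prod_brkt /= !hom_leibniz. Qed.
Fact prod_twist_brkt x y :
  prod_twist (prod_brkt x y) = prod_brkt (prod_twist x) (prod_twist y).
Proof. by rewrite /prod_twist /= !twist_brkt. Qed.

HB.instance Definition _ := isHomLeibniz.Build F P prod_brktl prod_brktr
  prod_twist_linear prod_leibniz prod_twist_brkt.

Fact fst_brkt (x y : P) : ⟦x, y⟧.1 = ⟦x.1, y.1⟧. Proof. by []. Qed.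
Fact fst_twist (x : P) : (twist x).1 = twist x.1. Proof. by []. Qed.
Fact snd_brkt (x y : P) : ⟦x, y⟧.2 = ⟦x.2, y.2⟧. Proof. by []. Qed.
Fact snd_twist (x : P) : (twist x).2 = twist x.2. Proof. by []. Qed.
HB.instance Definition _ := isHomLeibnizMorphism.Build F P K fst fst_brkt fst_twist.
HB.instance Definition _ := isHomLeibnizMorphism.Build F P L snd snd_brkt snd_twist.

Section Pair.
Variables (J : homLeibnizType F) (f : hlmorphism J K) (g : hlmorphism J L).
Definition pairing (x : J) : P := (f x, g x).
Fact pairing_linear : linear pairing.
Proof. by move=> a x y; rewrite /pairing !linearP. Qed.
HB.instance Definition _ := GRing.isLinear.Build F J P *:%R pairing pairing_linear.
Fact pairing_brkt x y : pairing ⟦x, y⟧ = ⟦pairing x, pairing y⟧.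
Proof. by rewrite /pairing !hlmorph_brkt. Qed.
Fact pairing_twist x : pairing (twist x) = twist (pairing x).
Proof. by rewrite /pairing !hlmorph_twist. Qed.
HB.instance Definition _ :=
  isHomLeibnizMorphism.Build F J P pairing pairing_brkt pairing_twist.
End Pair.
End Product.

(** * The abelianization L/[L,L] *)

Section Abelianization.
Variables (F : fieldType) (L : homLeibnizType F).

Definition derived : {pred L} := span (fun z : L => exists a b, z = ⟦a, b⟧).
HB.instance Definition _ := GRing.SubmodClosed.on derived.

Definition abz := lquot derived.
HB.instance Definition _ := GRing.Lmodule.on abz.

Definition abz_class : L -> abz := lclass derived.
HB.instance Definition _ := GRing.Linear.on abz_class.

(** The twist sends brackets to brackets, so it preserves [L,L] and descends to the quotient. *)
Fact abz_twist_subproof (v : L) : v \in derived -> (abz_class \o twist) v = 0.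
Proof.
case/spanP=> n [c [w [Sw ->]]]; apply/lclass_eq0.
rewrite linear_sum rpred_sum // => i _; rewrite linearZ /= rpredZ //.
apply: mem_span; have [a [b ->]] := Sw i.
by exists (twist a), (twist b); rewrite twist_brkt.
Qed.

Definition abz_brkt (x y : abz) : abz := 0.
Definition abz_twist : abz -> abz := lquot_lift abz_twist_subproof.
HB.instance Definition _ := GRing.Linear.on abz_twist.

Fact abz_brktl y : linear (abz_brkt^~ y).
Proof. by move=> a u v; rewrite /abz_brkt scaler0 addr0. Qed.
Fact abz_brktr x : linear (abz_brkt x).
Proof. by move=> a u v; rewrite /abz_brkt scaler0 addr0. Qed.
Fact abz_leibniz x y z : abz_brkt (abz_twist x) (abz_brkt y z) =
  abz_brkt (abz_brkt x y) (abz_twist z) - abz_brkt (abz_brkt x z) (abz_twist y).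
Proof. by rewrite /abz_brkt subrr. Qed.
Fact abz_twist_brkt x y :
  abz_twist (abz_brkt x y) = abz_brkt (abz_twist x) (abz_twist y).
Proof. exact: linear0. Qed.

HB.instance Definition _ := isHomLeibniz.Build F abz abz_brktl abz_brktr
  (@linearP _ _ _ _ abz_twist) abz_leibniz abz_twist_brkt.

Fact abz_class_brkt x y : abz_class ⟦x, y⟧ = ⟦abz_class x, abz_class y⟧.
Proof. by apply/lclass_eq0/mem_span; exists x, y. Qed.
Fact abz_class_twist x : abz_class (twist x) = twist (abz_class x).
Proof. by rewrite {2}/twist /= /abz_twist lquot_liftE. Qed.
HB.instance Definition _ :=
  isHomLeibnizMorphism.Build F L abz abz_class abz_class_brkt abz_class_twist.

End Abelianization.

Section Zero.
Variables (F : fieldType) (K L : homLeibnizType F).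
(** Serves as the second component of one of the two lifts compared in [unique_lift_perfect]. *)
Definition zerohl (x : K) : L := 0.
Fact zerohl_linear : linear zerohl.
Proof. by move=> a u v; rewrite /zerohl scaler0 addr0. Qed.
HB.instance Definition _ := GRing.isLinear.Build F K L *:%R zerohl zerohl_linear.
Fact zerohl_brkt x y : zerohl ⟦x, y⟧ = ⟦zerohl x, zerohl y⟧.
Proof. by rewrite /zerohl linear0l. Qed.
Fact zerohl_twist x : zerohl (twist x) = twist (zerohl x).
Proof. by rewrite /zerohl linear0. Qed.
HB.instance Definition _ := isHomLeibnizMorphism.Build F K L zerohl zerohl_brkt zerohl_twist.
End Zero.

(** * Central extensions *)

Section CentralKernel.
Variable F : fieldType.
Implicit Types M K L : homLeibnizType F.

(** [epi] and [central_ker] express a central extension through p alone; the kernel object M is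
    rebuilt only where a universal property asks for one. *)
Definition epi K L (p : K -> L) : Prop := forall l, exists k, p k = l.
Definition central_ker K L (p : K -> L) : Prop := forall k, p k = 0 -> center k.

Lemma central_extension_epi M K L (i : hlmorphism M K) (p : hlmorphism K L) :
  central_extension i p -> epi p.
Proof. by case=> -[]. Qed.

Lemma central_extension_ker M K L (i : hlmorphism M K) (p : hlmorphism K L) :
  central_extension i p -> central_ker p.
Proof. by case=> -[_ ip _] ic k /ip[m <-]. Qed.

Lemma short_exact_ker K L (p : hlmorphism K L) : epi p ->
  exists (M : homLeibnizType F) (i : hlmorphism M K),
    short_exact i p /\ forall m, p (i m) = 0.
Proof.
move=> ep.
have kerE x : (x \in inker p) = (p x == 0) by [].
have Wb x y : x \in inker p -> y \in inker p -> ⟦x, y⟧ \in inker p.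
  by rewrite !kerE hlmorph_brkt => /eqP-> _; rewrite linear0l.
have Wt x : x \in inker p -> twist x \in inker p.
  by rewrite !kerE hlmorph_twist => /eqP->; rewrite linear0.
have pi0 (m : subalg Wb Wt) : p (subalg_val m) = 0 by apply/eqP; case: m.
exists (subalg Wb Wt), (@subalg_val _ _ _ Wb Wt); split=> //; split=> //.
- exact: val_inj.
- move=> k; split=> [/eqP k0|[m <-]]; last exact: pi0.
  by exists (Subalg Wb Wt k0).
Qed.

Lemma central_ext_of_ker K L (p : hlmorphism K L) : epi p -> central_ker p ->
  exists (M : homLeibnizType F) (i : hlmorphism M K), central_extension i p.
Proof.
move=> /short_exact_ker[M [i [ip pi0]]] cp.
by exists M, i; split=> // m; apply/cp/pi0.
Qed.

Lemma alpha_central_ext_of_ker K L (p : hlmorphism K L) : epi p ->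
  (forall k, p k = 0 -> center (twist k)) ->
  exists (M : homLeibnizType F) (i : hlmorphism M K), alpha_central_extension i p.
Proof.
move=> /short_exact_ker[M [i [ip pi0]]] cp.
by exists M, i; split=> // m; rewrite hlmorph_twist; apply/cp/pi0.
Qed.

Lemma central_alpha_central M K L (i : hlmorphism M K) (p : hlmorphism K L) :
  central_extension i p -> alpha_central_extension i p.
Proof. by case=> ip ic; split=> // m; apply: ic. Qed.

(** Replace one argument at a time: x - x' and y - y' lie in the kernel of p, hence are central. *)
Lemma brkt_central K L (p : hlmorphism K L) : central_ker p ->
  forall x x' y y', p x = p x' -> p y = p y' -> ⟦x, y⟧ = ⟦x', y'⟧.
Proof.
move=> cp x x' y y' xx' yy'; apply/eqP; rewrite -subr_eq0.
have [xc _] : ⟦x - x', y⟧ = 0 /\ ⟦y, x - x'⟧ = 0.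
  by apply: cp; rewrite linearB /= xx' subrr.
have [_ yc] : ⟦y - y', x'⟧ = 0 /\ ⟦x', y - y'⟧ = 0.
  by apply: cp; rewrite linearB /= yy' subrr.
by move: xc yc; rewrite linearBl linearBr => /subr0_eq-> ->.
Qed.

Lemma perfect_ext K L (f g : {linear K -> L}) : perfect K ->
  (forall a b, f ⟦a, b⟧ = g ⟦a, b⟧) -> f =1 g.
Proof.
move=> pK fg x; have /spanP[n [c [w [Sw ->]]]] := pK x.
rewrite !linear_sum; apply: eq_bigr => i _; rewrite !linearZ /=.
by have [a [b ->]] := Sw i; rewrite fg.
Qed.

Lemma central_lift_unique K K' L (p : hlmorphism K L) (p' : hlmorphism K' L)
    (h h' : hlmorphism K K') : perfect K -> central_ker p' ->
  (forall k, p' (h k) = p k) -> (forall k, p' (h' k) = p k) -> h =1 h'.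
Proof.
move=> pK cp' hp h'p; apply: perfect_ext => // a b.
by rewrite /= !hlmorph_brkt; apply: (brkt_central cp'); rewrite hp h'p.
Qed.

Lemma epi_perfect K L (p : hlmorphism K L) : epi p -> perfect K -> perfect L.
Proof.
move=> ep pK l; have [k <-] := ep l.
have /spanP[n [c [w [Sw ->]]]] := pK k.
apply/spanP; exists n, c, (p \o w); split=> [i|] /=.
  by have [a [b ->]] := Sw i; exists (p a), (p b); rewrite hlmorph_brkt.
by rewrite linear_sum; apply: eq_bigr => i _; rewrite linearZ.
Qed.

(* Both k |-> (p k, 0) and k |-> (p k, class of k) lift p to L x K/[K,K], so
   uniqueness forces K = [K,K]. *)
Lemma unique_lift_perfect K L (p : hlmorphism K L) :
  unique_lift p (fst : hlmorphism (L * abz K)%type L) -> perfect K.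
Proof.
case=> h [_ hU] x; apply/lclass_eq0.
have /(congr1 snd) h0 := hU (pairing p (@zerohl F K (abz K))) (fun=> erefl) x.
have /(congr1 snd) hx := hU (pairing p (@abz_class F K)) (fun=> erefl) x.
exact: etrans hx (esym h0).
Qed.

(** The kernel 0 x K/[K,K] is central because the second factor has zero bracket. *)
Lemma fst_abz_central_ext K L :
  exists (M : homLeibnizType F) (i : hlmorphism M (L * abz K)%type),
  central_extension i (fst : hlmorphism (L * abz K)%type L).
Proof.
apply: central_ext_of_ker => [l|[k a] /= -> [l b]]; first by exists (l, 0).
by split; congr pair; rewrite /= ?linear0l ?linear0r.
Qed.

Lemma universal_perfect M K L (i : hlmorphism M K) (p : hlmorphism K L) :
  universal_central_extension i p -> perfect K.
Proof.
case=> _ U; have [M' [i' /U]] := fst_abz_central_ext K L.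
exact: unique_lift_perfect.
Qed.

(** Central extensions are alpha-central, so the alpha version quantifies over a larger class of
    extensions. *)
Lemma universal_alpha_universal M K L (i : hlmorphism M K) (p : hlmorphism K L) :
  universal_alpha_central_extension i p -> universal_central_extension i p.
Proof.
by case=> ip U; split=> // M' K' i' p' /central_alpha_central; apply: U.
Qed.

(* If p (q x) = 0 then q x is central, so all brackets with x are central; by the
   Hom-Leibniz identity twist x then kills [K',K'], which with ker q spans K'. *)
Lemma comp_alpha_central K' K L (q : hlmorphism K' K) (p : hlmorphism K L) :
  perfect K -> epi q -> central_ker q -> central_ker p ->
  forall x, (p \o q) x = 0 -> center (twist x).
Proof.
move=> pK eq cq cp x /= /cp xc.
have qx a : center ⟦x, a⟧ /\ center ⟦a, x⟧.
  by split; apply: cq; rewrite hlmorph_brkt; have [] := xc (q a).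
have brk0 a b : ⟦twist x, ⟦a, b⟧⟧ = 0 /\ ⟦⟦a, b⟧, twist x⟧ = 0.
  have E1 : ⟦twist x, ⟦a, b⟧⟧ = 0.
    rewrite hom_leibniz.
    have [/(_ (twist b))[-> _] _] := qx a.
    by have [/(_ (twist a))[-> _] _] := qx b; rewrite subrr.
  (* The identity for a, b, x writes [[a,b], twist x] through [twist a, [b,x]] and [[a,x], twist b],
     both zero by centrality of [b,x] and [a,x]. *)
  split=> //; have := hom_leibniz a b x.
  have [_ /(_ (twist a))[_ ->]] := qx b.
  have [_ /(_ (twist b))[-> _]] := qx a.
  by rewrite subr0.
move=> y; have /spanP[n [c [w [Sw qy]]]] := pK (q y).
have /choice[ab abw] : forall j, exists ab, w j = ⟦q ab.1, q ab.2⟧.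
  move=> j; have [a [b ->]] := Sw j.
  by have [[a' <-] [b' <-]] := (eq a, eq b); exists (a', b').
(* A combination of brackets with the same image as y under q, so that y - y' is central. *)
pose y' : K' := \sum_j c j *: ⟦(ab j).1, (ab j).2⟧.
have /cq/(_ (twist x))[zl zr] : q (y - y') = 0.
  rewrite linearB /= qy linear_sum -sumrB big1 // => j _.
  by rewrite linearZ /= hlmorph_brkt -abw subrr.
rewrite -(subrK y' y) linearDl linearDr /= zl zr !add0r /y'.
rewrite linear_sumlz linear_sumr !big1 //= => j _.
  by rewrite linearZl_LR /= (brk0 _ _).2 scaler0.
by rewrite linearZr_LR /= (brk0 _ _).1 scaler0.
Qed.

Lemma universal_alpha_splits M K L (i : hlmorphism M K) (p : hlmorphism K L) :
  universal_alpha_central_extension i p -> every_central_extension_splits K.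
Proof.
move=> U; have pK := universal_perfect (universal_alpha_universal U).
case: U => ip U M' K' j q jq.
have [ep cp] := (central_extension_epi ip, central_extension_ker ip).
have [eq cq] := (central_extension_epi jq, central_extension_ker jq).
have epq : epi (p \o q).
  by move=> l; have [k <-] := ep l; have [k' <-] := eq k; exists k'.
have [M2 [i2 /U[h [hp _]]]] :=
  alpha_central_ext_of_ker epq (comp_alpha_central pK eq cq cp).
(* Both [q \o h] and the identity lift p through p itself, so they coincide. *)
exists h => l.
exact: (central_lift_unique (h := q \o h) (h' := idfun) pK cp hp).
Qed.

Lemma splits_universal M K L (i : hlmorphism M K) (p : hlmorphism K L) :
  central_extension i p -> perfect K -> every_central_extension_splits K ->
  universal_central_extension i p.
Proof.
move=> ip pK sK; split=> // M' K' i' p' ip'.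
have [ep' cp'] := (central_extension_epi ip', central_extension_ker ip').
(* The kernel of d is the pullback of p and p' over L; its first projection q is a central extension
   of K. *)
pose d : {linear (K * K')%type -> L} := (p \o fst) \- (p' \o snd).
have dP x : (x \in inker d) = (p x.1 == p' x.2) by rewrite unfold_in subr_eq0.
have Wb x y : x \in inker d -> y \in inker d -> ⟦x, y⟧ \in inker d.
  by rewrite !dP !hlmorph_brkt => /eqP-> /eqP->.
have Wt x : x \in inker d -> twist x \in inker d.
  by rewrite !dP !hlmorph_twist => /eqP->.
pose q : hlmorphism (subalg Wb Wt) K := fst \o @subalg_val _ _ _ Wb Wt.
have eq : epi q.
  move=> k; have [k' k'k] := ep' (p k).
  have kk' : (k, k') \in inker d by rewrite dP k'k.
  by exists (Subalg Wb Wt kk').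
have cq : central_ker q.
  (* If q x = 0, the first component of x is 0, so its second component lies in the kernel of p' and
     is central in K'. *)
  move=> x x0; have /eqP xx' : p (val x).1 == p' (val x).2 by rewrite -dP; exact: valP x.
  have /cp' x'c : p' (val x).2 = 0 by rewrite -[LHS]xx' /= [X in p X]x0 linear0.
  move=> y; have [yl yr] := x'c (val y).2.
  by split; apply: val_inj; congr pair => //=;
    rewrite [X in ⟦X, _⟧]x0 ?linear0l || rewrite [X in ⟦_, X⟧]x0 linear0r.
have [M2 [i2 /sK[s sq]]] := central_ext_of_ker eq cq.
(* The second component of a section of q is a lift of p, by the equation defining the pullback. *)
pose h : hlmorphism K K' := snd \o (@subalg_val _ _ _ Wb Wt \o s).
have hp k : p' (h k) = p k.
  have /eqP <- : p (val (s k)).1 == p' (h k) by rewrite -dP; exact: valP (s k).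
  by rewrite -[X in p X]/(q (s k)) sq.
by exists h; split=> // h' h'p; apply: central_lift_unique h'p hp.
Qed.

End CentralKernel.

(** * The extension (L ⊗ L) / im d3 *)

Section UCE.
Variables (F : fieldType) (L : homLeibnizType F).

Definition uce := lquot (inim (d3 L)).
HB.instance Definition _ := GRing.Lmodule.on uce.

Definition uce_class : (L ⊗ L)%type -> uce := lclass (inim (d3 L)).
HB.instance Definition _ := GRing.Linear.on uce_class.

Definition tens_brkt : (L ⊗ L)%type -> L := tens_lift (@brkt F L).
HB.instance Definition _ := GRing.Linear.on tens_brkt.

Lemma tens_brktE x y : tens_brkt (x ⊗ y) = ⟦x, y⟧.
Proof. exact: tens_liftE. Qed.

(** The sign does not affect kernels: [tens_brkt] has kernel ker d2 and inherits vanishing on im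
    d3. *)
Lemma tens_brkt_d2 t : tens_brkt t = - d2 L t.
Proof.
have [n [u [v ->]]] := tens_gen t; rewrite !raddf_sum.
by apply: eq_bigr => i _; rewrite /= tens_brktE d2E opprK.
Qed.

Fact uce_proj_subproof t : t \in inim (d3 L) -> tens_brkt t = 0.
Proof. by case/inimP=> s <-; rewrite tens_brkt_d2 d2_d3 oppr0. Qed.

Definition uce_proj : uce -> L := lquot_lift uce_proj_subproof.
HB.instance Definition _ := GRing.Linear.on uce_proj.

Lemma uce_projE t : uce_proj (uce_class t) = tens_brkt t.
Proof. exact: lquot_liftE. Qed.

Definition tens_twist_fun (x y : L) : (L ⊗ L)%type := twist x ⊗ twist y.
Fact tens_twist_bilinear : bilinear_for *:%R *:%R tens_twist_fun.
Proof.
by split=> [y a x x'|x a y y']; rewrite /tens_twist_fun linearP (linearPl, linearPr).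
Qed.
HB.instance Definition _ := bilinear_isBilinear.Build F L L (L ⊗ L)%type *:%R *:%R
  tens_twist_fun tens_twist_bilinear.

Definition tens_twist : (L ⊗ L)%type -> (L ⊗ L)%type := tens_lift tens_twist_fun.
HB.instance Definition _ := GRing.Linear.on tens_twist.

Lemma tens_twistE x y : tens_twist (x ⊗ y) = twist x ⊗ twist y.
Proof. exact: tens_liftE. Qed.

Lemma tens_brkt_twist t : tens_brkt (tens_twist t) = twist (tens_brkt t).
Proof.
have [n [u [v ->]]] := tens_gen t; rewrite !raddf_sum; apply: eq_bigr => i _.
by rewrite /= tens_twistE !tens_brktE twist_brkt.
Qed.

(** Simple tensors span the triple tensor product and d3 is linear, so membership in a subspace may
    be tested on the relators. *)
Lemma inim_d3_ind (W : submodClosed (L ⊗ L)%type) :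
  (forall x y z, - (⟦x, y⟧ ⊗ twist z) + ⟦x, z⟧ ⊗ twist y + twist x ⊗ ⟦y, z⟧ \in W) ->
  forall t, t \in inim (d3 L) -> t \in W.
Proof.
move=> gW _ /inimP[s <-]; have [n [u [z ->]]] := tens_gen s.
rewrite raddf_sum rpred_sum // => i _.
have [m [x [y ->]]] := tens_gen (u i); rewrite linear_sumlz raddf_sum.
by rewrite rpred_sum // => j _; rewrite /= d3E.
Qed.

Lemma mem_d3 x y z :
  - (⟦x, y⟧ ⊗ twist z) + ⟦x, z⟧ ⊗ twist y + twist x ⊗ ⟦y, z⟧ \in inim (d3 L).
Proof. by apply/inimP; exists (x ⊗ y ⊗ z); exact: d3E. Qed.

(** Twisting the relator of x, y, z gives the relator of their twists. *)
Fact uce_twist_subproof t :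
  t \in inim (d3 L) -> (uce_class \o tens_twist) t = 0.
Proof.
move=> td; apply/eqP; rewrite -[_ == _]/(t \in inker (uce_class \o tens_twist)).
apply: inim_d3_ind td => x y z; apply/eqP/lclass_eq0 => /=.
by rewrite !linearD linearN /= !tens_twistE !twist_brkt mem_d3.
Qed.

Definition uce_twist : uce -> uce := lquot_lift uce_twist_subproof.
HB.instance Definition _ := GRing.Linear.on uce_twist.

Lemma uce_twistE t : uce_twist (uce_class t) = uce_class (tens_twist t).
Proof. exact: lquot_liftE. Qed.

Lemma uce_proj_twist u : uce_proj (uce_twist u) = twist (uce_proj u).
Proof.
by elim/lclassW: u => t; rewrite uce_twistE !uce_projE tens_brkt_twist.
Qed.

(** The arguments enter only through [uce_proj], which makes the bracket well defined on classes and
    the kernel of [uce_proj] central. *)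
Definition uce_brkt (u v : uce) : uce := uce_class (uce_proj u ⊗ uce_proj v).

Lemma uce_proj_brkt u v : uce_proj (uce_brkt u v) = ⟦uce_proj u, uce_proj v⟧.
Proof. by rewrite /uce_brkt uce_projE tens_brktE. Qed.

Fact uce_brktl v : linear (uce_brkt^~ v).
Proof. by move=> a u u'; rewrite /uce_brkt linearP linearPl linearP. Qed.
Fact uce_brktr u : linear (uce_brkt u).
Proof. by move=> a v v'; rewrite /uce_brkt linearP linearPr linearP. Qed.
(** The two sides differ by the class of the d3 relator of the projections of x, y, z. *)
Fact uce_leibniz x y z : uce_brkt (uce_twist x) (uce_brkt y z) =
  uce_brkt (uce_brkt x y) (uce_twist z) - uce_brkt (uce_brkt x z) (uce_twist y).
Proof.
rewrite /uce_brkt !uce_proj_twist !uce_proj_brkt -linearB; apply/lclass_eq.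
by rewrite opprB addrC [X in X + _]addrC; exact: mem_d3.
Qed.
Fact uce_twist_brkt x y :
  uce_twist (uce_brkt x y) = uce_brkt (uce_twist x) (uce_twist y).
Proof. by rewrite /uce_brkt uce_twistE tens_twistE !uce_proj_twist. Qed.

HB.instance Definition _ := isHomLeibniz.Build F uce uce_brktl uce_brktr
  (@linearP _ _ _ _ uce_twist) uce_leibniz uce_twist_brkt.
HB.instance Definition _ :=
  isHomLeibnizMorphism.Build F uce L uce_proj uce_proj_brkt uce_proj_twist.

Lemma uce_proj_central : central_ker uce_proj.
Proof.
by move=> u u0 v; rewrite /brkt /= /uce_brkt u0 linear0l linear0r !linear0.
Qed.

Hypothesis pL : perfect L.

(** The image of [uce_proj] contains all brackets, and these span L. *)
Lemma uce_proj_epi : epi uce_proj.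
Proof.
move=> l; have /spanP[n [c [w [Sw ->]]]] := pL l.
have /choice[ab abw] : forall j, exists ab, w j = ⟦ab.1, ab.2⟧.
  by move=> j; have [a [b ->]] := Sw j; exists (a, b).
exists (\sum_j c j *: uce_class ((ab j).1 ⊗ (ab j).2)).
rewrite linear_sum; apply: eq_bigr => j _.
by rewrite linearZ /= uce_projE tens_brktE abw.
Qed.

(** By surjectivity of [uce_proj], the class of each simple tensor is a bracket of preimages. *)
Lemma uce_perfect : perfect uce.
Proof.
elim/lclassW => t; have [n [x [y ->]]] := tens_gen t; rewrite [lclass _ _]raddf_sum.
apply: rpred_sum => i _; apply: mem_span.
have [[u ux] [v vy]] := (uce_proj_epi (x i), uce_proj_epi (y i)).
by exists u, v; rewrite /brkt /= /uce_brkt ux vy.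
Qed.

End UCE.

(** * Maps from (L ⊗ L)/im d3 into a central extension *)

Section CentralLift.
Variables (F : fieldType) (K L : homLeibnizType F) (p : hlmorphism K L).
Hypotheses (ep : epi p) (cp : central_ker p).

Lemma tens_central_lift : exists psi : {linear (L ⊗ L)%type -> K},
  forall x y, psi (p x ⊗ p y) = ⟦x, y⟧.
Proof.
(* s is a mere set-theoretic section; f is still bilinear, since brackets in K see only images under
   p. *)
have /choice[s sK] := ep.
pose f x y := ⟦s x, s y⟧.
have fb : bilinear_for *:%R *:%R f.
  split=> [y a x x'|x a y y']; rewrite /f -?linearPl -?linearPr;
  by apply: (brkt_central cp); rewrite ?linearP /= !sK.
pose b : {bilinear L -> L -> K} :=
  HB.pack f (bilinear_isBilinear.Build F L L K *:%R *:%R f fb).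
exists (tens_lift b) => x y; rewrite [LHS](tens_liftE b).
by apply: (brkt_central cp); rewrite sK.
Qed.

Variable psi : {linear (L ⊗ L)%type -> K}.
Hypothesis psiE : forall x y, psi (p x ⊗ p y) = ⟦x, y⟧.

Lemma proj_tens_lift t : p (psi t) = tens_brkt t.
Proof.
have [n [u [v ->]]] := tens_gen t; rewrite !raddf_sum; apply: eq_bigr => i _.
have [[x <-] [y <-]] := (ep (u i), ep (v i)).
by rewrite /= psiE tens_brktE hlmorph_brkt.
Qed.

(** After lifting x, y, z to K, the relator is sent to the Hom-Leibniz identity of the lifts. *)
Lemma tens_lift_d3 t : t \in inim (d3 L) -> psi t = 0.
Proof.
move=> td; apply/eqP; rewrite -[_ == _]/(t \in inker psi).
apply: inim_d3_ind td => x y z; apply/eqP.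
have [[[a <-] [b <-]] [c <-]] := (ep x, ep y, ep z).
rewrite -!hlmorph_brkt -!hlmorph_twist !linearD linearN /= !psiE hom_leibniz.
by rewrite addrACA addNr subrr addr0.
Qed.

Lemma uce_lift : exists h : hlmorphism (uce L) K,
  (forall u, p (h u) = uce_proj u) /\ forall t, h (uce_class t) = psi t.
Proof.
pose f : {linear uce L -> K} := lquot_lift tens_lift_d3.
have fE t : f (uce_class t) = psi t by apply: lquot_liftE.
have fp u : p (f u) = uce_proj u.
  by elim/lclassW: u => t; rewrite fE proj_tens_lift uce_projE.
have fb u v : f ⟦u, v⟧ = ⟦f u, f v⟧.
  (* Both sides equal psi at the tensor of the projections of u and v, as p after f is
     [uce_proj]. *)
  by rewrite {1}/brkt /= /uce_brkt fE -!fp psiE.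
have ft u : f (twist u) = twist (f u).
  elim/lclassW: u => t; have [n [x [y ->]]] := tens_gen t.
  rewrite [lclass _ _]raddf_sum !raddf_sum; apply: eq_bigr => i _.
  rewrite /= {1}/twist /= uce_twistE tens_twistE !fE.
  have [[a <-] [b <-]] := (ep (x i), ep (y i)).
  by rewrite -!hlmorph_twist !psiE twist_brkt.
pose h : hlmorphism (uce L) K := HB.pack (f : uce L -> K)
  (GRing.Linear.class f) (isHomLeibnizMorphism.Build F (uce L) K f fb ft).
by exists h.
Qed.

End CentralLift.

(** * Universality and the comparison with second homology *)

Section Universal.
Variable F : fieldType.

Lemma uce_unique_lift (L K : homLeibnizType F) (p : hlmorphism K L) :
  perfect L -> epi p -> central_ker p -> unique_lift (@uce_proj F L) p.
Proof.
move=> pL ep cp; have [psi psiE] := tens_central_lift ep cp.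
have [h [hp _]] := uce_lift ep psiE.
exists h; split=> // h' h'p.
exact: central_lift_unique (uce_perfect pL) cp h'p hp.
Qed.

Lemma uce_universal (L : homLeibnizType F) : perfect L ->
  exists (M : homLeibnizType F) (i : hlmorphism M (uce L)),
    universal_central_extension i (@uce_proj F L).
Proof.
move=> pL; have [M [i ip]] :=
  central_ext_of_ker (uce_proj_epi pL) (@uce_proj_central F L).
exists M, i; split=> // M' K' i' p' ip'; apply: uce_unique_lift => //.
  exact: central_extension_epi ip'.
exact: central_extension_ker ip'.
Qed.

Lemma universal_HL2 (L M K : homLeibnizType F) (i : hlmorphism M K)
    (p : hlmorphism K L) : perfect L -> universal_central_extension i p ->
  exists phi : {linear HL2 L -> M}, bijective phi /\ canonical_HL2_map i p phi.
Proof.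
move=> pL Up; have [ip U] := Up.
have [ep cp] := (central_extension_epi ip, central_extension_ker ip).
have [psi psiE] := tens_central_lift ep cp.
have [h [hp hE]] := uce_lift ep psiE.
have [M' [i' [ip' _]]] := uce_universal pL.
have [g [gp _]] := U _ _ _ _ ip'.
(* Each composite of h and g lies over L, as does the identity, so uniqueness of lifts makes them
   mutually inverse. *)
have hg k : h (g k) = k.
  apply: (central_lift_unique (h := h \o g) (h' := idfun)
    (universal_perfect Up) cp (p := p)) => //= x.
  by rewrite hp gp.
have gh u : g (h u) = u.
  apply: (central_lift_unique (h := g \o h) (h' := idfun)
    (uce_perfect pL) (@uce_proj_central F L) (p := @uce_proj F L)) => //= x.
  by rewrite gp hp.
have [[iI ker_p _] _] := ip.
(* On cycles psi lands in the kernel of p, which is the image of i; injectivity of i then makes the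
   chosen preimages depend linearly on the cycle. *)
have /choice[f fE] : forall z : kernel (d2 L), exists m, i m = psi (kernel_val z).
  move=> z; apply/ker_p.
  by rewrite (proj_tens_lift ep psiE) tens_brkt_d2 kernelP oppr0.
have fl : linear f.
  by move=> a x y; apply: iI; rewrite [RHS]linearP /= !fE; exact: linearP.
pose f' : {linear kernel (d2 L) -> M} :=
  HB.pack f (GRing.isLinear.Build F (kernel (d2 L)) M *:%R f fl).
have f0 z : z \in inim (@d3_cor_fun F L) -> f' z = 0.
  case/inimP=> t <-; apply: iI; rewrite fE linear0.
  by apply: (tens_lift_d3 ep psiE); apply/inimP; exists t.
pose phi : {linear HL2 L -> M} := lquot_lift f0.
have phiE z : i (phi (HL2_class z)) = psi (kernel_val z).
  by rewrite [phi _]lquot_liftE fE.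
exists phi; split; last by exists psi.
have phiI : injective phi.
  apply: raddf_inj; elim/lclassW => z /(congr1 i); rewrite phiE linear0 -hE => hz.
  (* h kills the class of z; applying its inverse g shows that z is a boundary. *)
  have /lclass_eq0/inimP[t tz] : uce_class (kernel_val z) = 0.
    by rewrite -(gh (uce_class _)) hz linear0.
  by apply/lclass_eq0/inimP; exists t; apply: val_inj.
have /choice[r rE] : forall m, exists c, phi c = m.
  (* A representative t of g (i m) is a cycle because g lies over L and p (i m) = 0; its homology
     class is the preimage of m. *)
  move=> m; have [t tE] : exists t, uce_class t = g (i m).
    by elim/lclassW: (g (i m)) => t; exists t.
  have t0 : t \in inker (d2 L).
    rewrite unfold_in -oppr_eq0 -tens_brkt_d2 -uce_projE tE gp.
    by apply/eqP/ker_p; exists m.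
  exists (HL2_class (Kernel t0)); apply: iI.
  by rewrite phiE /= -hE tE hg.
by exists r => // x; apply: phiI.
Qed.

End Universal.

Theorem theorem4p11 (F : fieldType) :
  (forall (M K L : homLeibnizType F) (i : hlmorphism M K) (p : hlmorphism K L),
     universal_alpha_central_extension i p ->
     perfect K /\ every_central_extension_splits K)
  /\
  (forall (M K L : homLeibnizType F) (i : hlmorphism M K) (p : hlmorphism K L),
     central_extension i p ->
     perfect K -> every_central_extension_splits K ->
     universal_central_extension i p)
  /\
  (forall L : homLeibnizType F,
     (exists (M K : homLeibnizType F) (i : hlmorphism M K) (p : hlmorphism K L),
        universal_central_extension i p)
     <-> perfect L)
  /\
  (forall (L M K : homLeibnizType F) (i : hlmorphism M K) (p : hlmorphism K L),
     perfect L -> universal_central_extension i p ->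
     exists phi : {linear HL2 L -> M}, bijective phi /\ canonical_HL2_map i p phi).
Proof.
split=> [M K L i p U|].
  split; last exact: universal_alpha_splits U.
  exact: universal_perfect (universal_alpha_universal U).
split; first exact: splits_universal.
split; last exact: universal_HL2.
move=> L; split=> [[M [K [i [p U]]]]|/uce_universal[M [i U]]].
  (* Perfectness of the universal K passes to its quotient L. *)
  exact: epi_perfect (central_extension_epi U.1) (universal_perfect U).
by exists M, (uce L), i, (@uce_proj F L).
Qed.
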